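(* Let $\mathcal{C}$ be a finite family, with $|\mathcal{C}|\ge 4$, of compact convex sets in $\mathbb{R}^2$, all contained in the open unit disk, satisfying the $(4,3)$-property. If $\Delta\subset A_1\cup A_2\cup A_3\cup A_4$, then there exists $x\in A_1\cap A_2\cap A_3\cap A_4$.
   Context: The $(4,3)$-property: among every $4$ members some $3$ have a common point. $f(t)=(\cos 2\pi t,-\sin 2\pi t)$; $[a,b]$ is a segment. $\Delta=\{x\in\mathbb{R}^4:x_i\ge0,\ \sum x_i=1\}$ is the $3$-simplex with vertices $e_1,\dots,e_4$. For $x\in\Delta$ and $1\le i\le4$, $R^i_x$ is the interior of the region bounded by the arc of the unit circle from $f(\sum_{j<i}x_j)$ to $f(\sum_{j\le i}x_j)$ (empty sum $=0$) and the segments $[(1,0),f(x_1+x_2)]$, $[f(x_1),f(x_1+x_2+x_3)]$ (the open piece of the disk cut by these two chords adjacent to the $i$-th arc; empty if $x_i=0$). $A_i$ is the set of $x\in\Delta$ for which there are $C_1,C_2,C_3\in\mathcal{C}$ with $C_1\cap C_2\cap C_3\ne\emptyset$ and $C_j\cap C_k\subset R^i_x$ for all $1\le j<k\le3$. *)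

(* Defs.v *)
From HB Require Import structures.
From mathcomp Require Import all_boot all_order all_algebra finmap.
From mathcomp Require Import all_classical all_reals all_analysis.

Set Implicit Arguments.
Unset Strict Implicit.
Unset Printing Implicit Defensive.

Import Order.TTheory GRing.Theory Num.Theory.
Import numFieldNormedType.Exports.

Local Open Scope classical_set_scope.
Local Open Scope ring_scope.

(* [R^o] rather than [R], so that the product is a normed module over [R];
   its sup norm only provides the (usual) topology. *)
Definition plane (R : realType) := (R^o * R^o)%type.

Definition open_unit_disk (R : realType) : set (plane R) :=
  [set p | p.1 ^+ 2 + p.2 ^+ 2 < 1].
Arguments open_unit_disk : clear implicits.

Definition segment (R : realType) (a b : plane R) : set (plane R) :=
  [set (1 - t) *: a + t *: b | t in `[0, 1]].

(* Subfamilies are finite sets, so the [p] members and the [q] members among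
   them are pairwise distinct. *)
Definition pq_property (T : Type) (p q : nat) (C : {fset set T}) : Prop :=
  forall D : {fset set T}, (D `<=` C)%fset -> #|` D| = p ->
  exists E : {fset set T},
    [/\ (E `<=` D)%fset, #|` E| = q & exists z : T, forall X, X \in E -> X z].

Definition simplex (R : realType) : set 'rV[R]_4 :=
  [set x | (forall i, 0 <= x 0 i) /\ \sum_i x 0 i = 1].
Arguments simplex : clear implicits.

Definition circle_pt (R : realType) (t : R) : plane R :=
  (cos (2 * pi * t), - sin (2 * pi * t)).

(* Coordinates are indexed from 0: [psum x k] is the sum of the first [k]
   coordinates, and the arc of index [i : 'I_4] runs from parameter [psum x i]
   to parameter [psum x i.+1]. *)
Definition psum (R : realType) (x : 'rV[R]_4) (k : nat) : R :=
  \sum_(j < 4 | (j < k)%N) x 0 j.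

Definition circle_arc (R : realType) (x : 'rV[R]_4) (i : 'I_4) : set (plane R) :=
  [set circle_pt t | t in `[psum x i, psum x i.+1]].

Definition chords (R : realType) (x : 'rV[R]_4) : set (plane R) :=
  segment (1, 0) (circle_pt (psum x 2)) `|`
  segment (circle_pt (psum x 1)) (circle_pt (psum x 3)).

Definition cut_disk (R : realType) (x : 'rV[R]_4) : set (plane R) :=
  open_unit_disk R `\` chords x.

(* The interior of the region bounded by the [i]-th arc and the chords, as the
   connected component of the cut disk whose boundary contains that arc.  The
   condition [0 < x 0 i] makes the region empty when the arc is reduced to a
   point, which may be adherent to several components.  When some coordinates
   vanish, chords may share endpoints, coincide, or be reduced to a point of the
   circle. *)
Definition region (R : realType) (x : 'rV[R]_4) (i : 'I_4) : set (plane R) :=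
  [set p | [/\ 0 < x 0 i, cut_disk x p &
     circle_arc x i `<=` closure (connected_component (cut_disk x) p)]].

Definition A_ (R : realType) (C : {fset set (plane R)}) (i : 'I_4) :
    set 'rV[R]_4 :=
  [set x | simplex R x /\ exists D : 'I_3 -> set (plane R),
    [/\ forall j, D j \in C,
        \bigcap_j D j !=set0 &
        forall j k : 'I_3, (j < k)%N -> D j `&` D k `<=` region x i]].

(* Main.v *)
(* The sets [A_ C i] are relatively open in the simplex, and [A_ C i] does not
   meet the facet [x_i = 0], since the region of a degenerate arc is empty; so
   the open KKM theorem applies.  For openness, the region of index [i] is the
   set of points of the disk lying on the side of the [i]-th arc with respect to
   both chords, i.e. it is cut out by two strict inequalities depending
   continuously on [x] and on the point; by compactness of the pairwise
   intersections these inequalities persist for nearby [x].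

   KKM follows from Sperner's lemma and a Lebesgue number of the cover.
   Sperner's lemma is proved by extending the labelling of the subdivided simplex
   to a box around it, with the labels [std_label] outside: the signed number of
   fully labelled cells is a boundary term, hence the same for all labellings
   that agree on the boundary of the box, and it is 1 for [std_label]. *)
Require Import Defs.
From mathcomp Require Import all_boot all_order all_algebra finmap.
From mathcomp Require Import all_classical all_reals all_analysis.
From mathcomp Require Import zify ring lra.
Import Order.TTheory GRing.Theory Num.Theory.
Import numFieldNormedType.Exports.
Local Open Scope classical_set_scope.
Local Open Scope ring_scope.

Set Implicit Arguments.
Unset Strict Implicit.
Unset Printing Implicit Defensive.

(** * Sperner's lemma *)

(* Signed indicator of the triangles labelled 0, 1, 2.  Its coboundary [room]
   vanishes unless all four labels occur. *)
Definition door (a b c : nat) : int :=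
  match a, b, c with
  | 0, 1, 2 | 1, 2, 0 | 2, 0, 1 => 1
  | 0, 2, 1 | 2, 1, 0 | 1, 0, 2 => -1
  | _, _, _ => 0
  end.

Definition room (a b c d : nat) : int :=
  door b c d - door a c d + door a b d - door a b c.

Lemma room_neq0 (a b c d i : 'I_4) :
  room a b c d != 0 -> i \in [:: a; b; c; d].
Proof.
by case: a b c d i => [[|[|[|[|]]]]//= ?] [[|[|[|[|]]]]//= ?]
  [[|[|[|[|]]]]//= ?] [[|[|[|[|]]]]//= ?] [[|[|[|[|]]]]//= ?].
Qed.

Section Grid.
Local Open Scope nat_scope.
Implicit Types (l : nat -> nat -> nat -> 'I_4) (x y z n : nat).

(* The six simplices of Kuhn's triangulation of a unit cube, counted with the
   sign of the permutation, so that the contributions of the facets inside the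
   cube cancel. *)
Definition cell l x y z : int :=
  (room (l x y z) (l x.+1 y z) (l x.+1 y.+1 z) (l x.+1 y.+1 z.+1)
   - room (l x y z) (l x.+1 y z) (l x.+1 y z.+1) (l x.+1 y.+1 z.+1)
   + room (l x y z) (l x y.+1 z) (l x y.+1 z.+1) (l x.+1 y.+1 z.+1)
   - room (l x y z) (l x y.+1 z) (l x.+1 y.+1 z) (l x.+1 y.+1 z.+1)
   + room (l x y z) (l x y z.+1) (l x.+1 y z.+1) (l x.+1 y.+1 z.+1)
   - room (l x y z) (l x y z.+1) (l x y.+1 z.+1) (l x.+1 y.+1 z.+1))%R.

Definition faceX l x y z : int :=
  (door (l x y z) (l x y.+1 z) (l x y.+1 z.+1)
   - door (l x y z) (l x y z.+1) (l x y.+1 z.+1))%R.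
Definition faceY l x y z : int :=
  (door (l x y z) (l x y z.+1) (l x.+1 y z.+1)
   - door (l x y z) (l x.+1 y z) (l x.+1 y z.+1))%R.
Definition faceZ l x y z : int :=
  (door (l x y z) (l x.+1 y z) (l x.+1 y.+1 z)
   - door (l x y z) (l x y.+1 z) (l x.+1 y.+1 z))%R.

Lemma cellE l x y z :
  cell l x y z = (faceX l x.+1 y z - faceX l x y z
                + (faceY l x y.+1 z - faceY l x y z)
                + (faceZ l x y z.+1 - faceZ l x y z))%R.
Proof. rewrite /cell /room /faceX /faceY /faceZ; ring. Qed.

Definition total n l : int :=
  (\sum_(0 <= x < n) \sum_(0 <= y < n) \sum_(0 <= z < n) cell l x y z)%R.

(** A discrete divergence theorem: by [cellE] each cube contributes differences of opposite face
    terms, which telescope along the three axes. *)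
Lemma totalE n l : total n l =
  (\sum_(0 <= y < n) \sum_(0 <= z < n) (faceX l n y z - faceX l 0 y z)
   + \sum_(0 <= x < n) \sum_(0 <= z < n) (faceY l x n z - faceY l x 0 z)
   + \sum_(0 <= x < n) \sum_(0 <= y < n) (faceZ l x y n - faceZ l x y 0))%R.
Proof.
transitivity (
  \sum_(0 <= x < n) \sum_(0 <= y < n) \sum_(0 <= z < n)
    (faceX l x.+1 y z - faceX l x y z)
  + \sum_(0 <= x < n) \sum_(0 <= y < n) \sum_(0 <= z < n)
    (faceY l x y.+1 z - faceY l x y z)
  + \sum_(0 <= x < n) \sum_(0 <= y < n) \sum_(0 <= z < n)
    (faceZ l x y z.+1 - faceZ l x y z))%R.
  rewrite -!big_split; apply: eq_bigr => x _.
  rewrite -!big_split; apply: eq_bigr => y _.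
  by rewrite -!big_split; apply: eq_bigr => z _; rewrite cellE.
congr (_ + _ + _)%R.
- rewrite exchange_big_nat /=; apply: eq_bigr => y _.
  rewrite exchange_big_nat /=; apply: eq_bigr => z _.
  exact: (telescope_sumr (fun x => faceX l x y z)).
- apply: eq_bigr => x _.
  rewrite exchange_big_nat /=; apply: eq_bigr => z _.
  exact: (telescope_sumr (fun y => faceY l x y z)).
- apply: eq_bigr => x _; apply: eq_bigr => y _.
  exact: (telescope_sumr (fun z => faceZ l x y z)).
Qed.

Lemma eq_total n l l' :
  (forall x y z, [|| x == 0, x == n, y == 0, y == n, z == 0 | z == n] ->
     l x y z = l' x y z) ->
  total n l = total n l'.
Proof.
move=> ll'; rewrite !totalE; congr (_ + _ + _)%R;
  do 2 (apply: eq_bigr => ? _);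
  by rewrite /faceX /faceY /faceZ !ll' ?eqxx ?orbT.
Qed.

(* The grid point [(x, y, z)] stands for the lattice point
   [(x - 1, y - x, z - y, n + 1 - z)] of the simplex of size [n]; partial sums
   make the simplex compatible with Kuhn's triangulation, and the shift by 1 puts
   it in the interior of the box of side [n + 2]. *)
Definition positive n x y z (i : 'I_4) : bool :=
  nth false [:: 1 < x; x < y; y < z; z < n.+1] i.

Definition inside n x y z : bool := [&& 0 < x, x <= y, y <= z & z <= n.+1].

(** The index of the first positive coordinate; if the first three are not positive then [z <= 1],
    so the last one is positive when [0 < n]. *)
Definition std_label x y z : 'I_4 :=
  inord (if 1 < x then 0 else if x < y then 1 else if y < z then 2 else 3).

Lemma positive_std_label n x y z : 0 < n -> positive n x y z (std_label x y z).
Proof.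
move=> n0; rewrite /positive /std_label.
case: (ltnP 1 x) => [|x1]; first by rewrite inordK.
case: (ltnP x y) => [|yx]; first by rewrite inordK.
by case: (ltnP y z) => [|zy]; rewrite inordK //=; lia.
Qed.

Definition kuhn : seq (seq (nat * nat * nat)) :=
  [:: [:: (0, 0, 0); (1, 0, 0); (1, 1, 0); (1, 1, 1)];
      [:: (0, 0, 0); (1, 0, 0); (1, 0, 1); (1, 1, 1)];
      [:: (0, 0, 0); (0, 1, 0); (0, 1, 1); (1, 1, 1)];
      [:: (0, 0, 0); (0, 1, 0); (1, 1, 0); (1, 1, 1)];
      [:: (0, 0, 0); (0, 0, 1); (1, 0, 1); (1, 1, 1)];
      [:: (0, 0, 0); (0, 0, 1); (0, 1, 1); (1, 1, 1)]].

Lemma cell_neq0 l x y z : cell l x y z != 0%R ->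
  exists2 s, s \in kuhn & forall i, exists2 d, d \in s &
    l (d.1.1 + x) (d.1.2 + y) (d.2 + z) = i.
Proof.
move=> c0.
have [s sk Hs] : exists2 s, s \in kuhn &
    forall i, i \in [seq l (d.1.1 + x) (d.1.2 + y) (d.2 + z) | d <- s].
  apply: contrapT => noroom; move/eqP: c0; apply.
  have room0 s : s \in kuhn ->
      let l' d := l (d.1.1 + x) (d.1.2 + y) (d.2 + z) in
      let p := (0, 0, 0) in
      room (l' (nth p s 0)) (l' (nth p s 1)) (l' (nth p s 2)) (l' (nth p s 3))
        = 0%R.
    move=> sk; apply/eqP/negPn/negP => r0; apply: noroom; exists s => // i.
    by have := room_neq0 i r0; rewrite !inE in sk; move: sk;
      do 5?[case/orP => [/eqP -> //|]]; move/eqP ->.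
  have A i : i < 6 -> nth [::] kuhn i \in kuhn by move=> ?; apply: mem_nth.
  rewrite /cell (room0 _ (A 0 _)) ?(room0 _ (A 1 _)) ?(room0 _ (A 2 _)) //.
  by rewrite (room0 _ (A 3 _)) ?(room0 _ (A 4 _)) ?(room0 _ (A 5 _)).
exists s => // i; have /mapP[d ds ->] := Hs i; by exists d.
Qed.

(** Comparability keeps the difference of two grid coordinates from varying by more than 1 on a
    simplex. Checked by enumeration. *)
Lemma kuhn_chain s d d' : s \in kuhn -> d \in s -> d' \in s ->
  [&& d.1.1 <= 1, d.1.2 <= 1, d.2 <= 1, d'.1.1 <= 1, d'.1.2 <= 1, d'.2 <= 1 &
   [&& d.1.1 <= d'.1.1, d.1.2 <= d'.1.2 & d.2 <= d'.2]
   || [&& d'.1.1 <= d.1.1, d'.1.2 <= d.1.2 & d'.2 <= d.2]].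
Proof.
have K : all (fun s => all (fun d => all (fun d' =>
  [&& d.1.1 <= 1, d.1.2 <= 1, d.2 <= 1, d'.1.1 <= 1, d'.1.2 <= 1, d'.2 <= 1 &
   [&& d.1.1 <= d'.1.1, d.1.2 <= d'.1.2 & d.2 <= d'.2]
   || [&& d'.1.1 <= d.1.1, d'.1.2 <= d.1.2 & d'.2 <= d.2]]) s) s) kuhn by [].
by move=> sk ds d's; move/allP: K => /(_ _ sk)/allP/(_ _ ds)/allP; exact.
Qed.

Lemma cell_eq0 l x y z (i : 'I_4) :
  (forall a b c, a <= 1 -> b <= 1 -> c <= 1 -> l (a + x) (b + y) (c + z) != i) ->
  cell l x y z = 0%R.
Proof.
move=> noi; apply/eqP/negPn/negP => /cell_neq0[s sk] /(_ i)[d ds].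
have /and4P[d1 d2 d3 _] := kuhn_chain sk ds ds.
by apply/eqP; exact: noi.
Qed.

Lemma std_labelE x y z : std_label x y z =
  (if 1 < x then 0 else if x < y then 1 else if y < z then 2 else 3) :> nat.
Proof.
by rewrite /std_label inordK //; case: ifP => // _; case: ifP => // _; case: ifP.
Qed.

Lemma cell_std_label x y z : cell std_label x y z =
  (if [&& x == 1, y == 1 & z == 1] then 1 else 0)%R.
Proof.
case: ifP => [/and3P[/eqP-> /eqP-> /eqP->]|xyz].
  by rewrite /cell /room !std_labelE.
(* A label that no corner of the cube carries: each coordinate is examined once the preceding ones
   are known to equal 1. *)
pose i := if x == 0 then 0 else if 1 < x then 1 else if y == 0 then 1 else
          if 1 < y then 2 else if z == 0 then 2 else 3.
have i4 : i < 4.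
  by rewrite /i; do 4!case: ifP => //; case: ifP.
apply: (@cell_eq0 std_label x y z (Ordinal i4)) => a b c a1 b1 c1.
rewrite -val_eqE/= std_labelE /i.
by apply/negP; move: xyz; do !(case: ifP; try by []); lia.
Qed.

Lemma total_std_label n : 1 < n -> total n std_label = 1%R.
Proof.
move=> n1; rewrite /total.
rewrite !big_mkord (bigD1 (Ordinal n1))//= [X in (_ + X)%R]big1; last first.
  move=> i; rewrite -val_eqE /= => i1.
  by do 2 (rewrite big1 // => ? _); rewrite cell_std_label (negPf i1).
rewrite !big_mkord (bigD1 (Ordinal n1))//= [X in (_ + X + _)%R]big1; last first.
  move=> i; rewrite -val_eqE /= => i1.
  by rewrite big1 // => ? _; rewrite cell_std_label (negPf i1).
rewrite !big_mkord (bigD1 (Ordinal n1))//= [X in (_ + X + _ + _)%R]big1.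
  by rewrite cell_std_label.
move=> i; rewrite -val_eqE /= => i1.
by rewrite cell_std_label (negPf i1).
Qed.

Lemma sperner n (l : nat -> nat -> nat -> 'I_4) : 0 < n ->
  (forall x y z, inside n x y z -> positive n x y z (l x y z)) ->
  exists x y z, forall i, exists a b c, [/\ a <= 1, b <= 1, c <= 1,
    inside n (a + x) (b + y) (c + z) & l (a + x) (b + y) (c + z) = i].
Proof.
move=> n0 lP.
pose m x y z := if inside n x y z then l x y z else std_label x y z.
have mP x y z : positive n x y z (m x y z).
  by rewrite /m; case: ifP => [/lP//|_]; exact: positive_std_label.
(* No boundary point of the box is [inside], so [m] agrees there with [std_label]. *)
have : (total n.+2 m != 0)%R.
  rewrite (@eq_total _ m std_label) ?total_std_label// /m => x y z.
  by case: ifP => // /and4P[]; lia.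
move=> /eqP tot.
have [[[x y] z] c0] : exists p : nat * nat * nat, cell m p.1.1 p.1.2 p.2 != 0%R.
  apply: contrapT => nocell; apply: tot; rewrite /total.
  rewrite big1 // => a _; rewrite big1 // => b _; rewrite big1 // => c _.
  by apply/eqP/negPn/negP => c0; apply: nocell; exists (a, b, c).
have [s sk Hs] := cell_neq0 c0.
have ins d : d \in s -> inside n (d.1.1 + x) (d.1.2 + y) (d.2 + z).
  move=> ds; apply/negPn/negP => out.
  (* A simplex with a vertex outside satisfies an inequality [x_i <= 0], because
     each coordinate takes at most two consecutive values on it; then no vertex has
     label [i]. *)
  have [i Hi] : exists i : 'I_4, forall d', d' \in s ->
      ~~ positive n (d'.1.1 + x) (d'.1.2 + y) (d'.2 + z) i.
    pose i := if d.1.1 + x == 0 then 0 else if d.1.2 + y < d.1.1 + x then 1 else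
              if d.2 + z < d.1.2 + y then 2 else 3.
    have i4 : i < 4 by rewrite /i; do 2!case: ifP => //; case: ifP.
    exists (Ordinal i4) => d' d's; have := kuhn_chain sk ds d's.
    move: out; rewrite /positive /inside /= /i.
    by case: ifP => /= [|?]; [lia|case: ifP => /= [|?]; [lia|case: ifP => /=; lia]].
  have [d' d's d'i] := Hs i; have /negP := Hi _ d's; apply.
  by rewrite -[X in positive _ _ _ _ X]d'i; exact: mP.
exists x, y, z => i; have [d ds di] := Hs i.
have /and4P[d1 d2 d3 _] := kuhn_chain sk ds ds.
exists d.1.1, d.1.2, d.2; split=> //; first exact: ins.
by rewrite -di /= /m ins.
Qed.

End Grid.

(** * The KKM theorem *)

Lemma continuous_coord_sum (R : realType) n (P : pred 'I_n) :
  continuous (fun v : 'rV[R]_n => \sum_(i | P i) v 0 i).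
Proof.
elim: (index_enum _) => [|i s IH].
  rewrite (_ : (fun v => _) = cst 0); first exact: cst_continuous.
  by apply/funext => w; rewrite big_nil.
rewrite (_ : (fun v => _) = fun v : 'rV[R]_n =>
    (if P i then v 0 i else 0) + \sum_(j <- s | P j) v 0 j).
  move=> v; apply: continuousD; last exact: IH.
  by case: (P i); [exact: coord_continuous|exact: cst_continuous].
by apply/funext => w; rewrite big_cons; case: (P i); rewrite ?add0r.
Qed.

Lemma compact_simplex (R : realType) : compact (simplex R).
Proof.
have -> : simplex R = [set v : 'rV[R]_4 | forall i, `[0, 1]%classic (v ord0 i)]
    `&` [set v | \sum_i v 0 i = 1].
  apply/seteqP; split=> [x [x0 x1]|x [x01 x1]]; split=> // i /=.
    rewrite in_itv/= x0 -x1 (bigD1 i)//= lerDl; exact: sumr_ge0.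
  by have /= := x01 i; rewrite in_itv/= => /andP[].
apply: compact_closedI.
  apply: (@rV_compact R 4 (fun=> `[0, 1]%classic)) => _.
  exact: segment_compact.
have cs : continuous (fun v : 'rV[R]_4 => \sum_i v 0 i) by
  exact: continuous_coord_sum.
by move/continuous_closedP: cs => /(_ [set 1]); apply; exact: closed_eq.
Qed.

(** If the ball of radius [e] at a point works for [B i], then radius [e / 2] works at all centres
    within [e / 2]; compactness makes one radius valid on all of [K]. *)
Lemma lebesgue_number (R : realType) (I : Type) (M : pseudoMetricType R)
    (K : set M) (B : I -> set M) : compact K ->
  (forall i x, K x -> B i x -> \forall y \near x, K y -> B i y) ->
  K `<=` \bigcup_i B i ->
  exists2 d : R, 0 < d &
    forall x, K x -> exists i, forall y, K y -> ball x d y -> B i y.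
Proof.
move=> cK oB cover.
pose P (d : R) x := exists i, forall y, K y -> ball x d y -> B i y.
have nearP : \forall d \near 0^'+, K `<=` P d.
  apply: (compact_near_coveringP K).1 => // x Kx.
  have [i _ Bix] := cover _ Kx.
  have /nbhs_ballP[e /= e0 He] := oB i x Kx Bix.
  exists (ball x (e / 2), [set d | d < e / 2]) => /=.
    split; first by apply: nbhsx_ballx; rewrite divr_gt0.
    by apply: nbhs_right_lt; rewrite divr_gt0.
  move=> [x' d]/= [xx' de]; exists i => y Ky x'y; apply: He => //.
  by apply: ball_split xx' _; exact: le_ball (ltW de) _ x'y.
have : \forall d \near (0 : R)^'+, K `<=` P d /\ 0 < d.
  by apply: filterI => //; exact: nbhs_right_gt.
by move=> /(@filter_ex _ _ (at_right_proper_filter (0 : R)))[d [Kd d0]]; exists d.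
Qed.

Definition grid_pt (R : realType) (n x y z : nat) : 'rV[R]_4 :=
  \row_i (nth 0 [:: x%:R - 1; y%:R - x%:R; z%:R - y%:R; n.+1%:R - z%:R] i / n%:R).

Lemma simplex_grid_pt (R : realType) n x y z : (0 < n)%N -> inside n x y z ->
  simplex R (grid_pt R n x y z).
Proof.
move=> n0 /and4P[x1 xy yz zn]; split=> [i|].
  rewrite mxE divr_ge0//.
  by case: i => [[|[|[|[|]]]]] //= _; rewrite subr_ge0 ?ler1n ?ler_nat.
rewrite !big_ord_recl big_ord0 !mxE /= -natr1.
have : n%:R != 0 :> R by rewrite pnatr_eq0 -lt0n.
by move=> ?; field.
Qed.

Lemma positive_grid_pt (R : realType) n x y z i : (0 < n)%N ->
  0 < grid_pt R n x y z 0 i -> positive n x y z i.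
Proof.
move=> n0; rewrite mxE pmulr_lgt0 ?invr_gt0 ?ltr0n//.
by case: i => [[|[|[|[|]]]]] //= ?; rewrite subr_gt0 ?ltr1n ?ltr_nat.
Qed.

(** A grid point is labelled by an [i] such that [B i] contains its [d]-ball in the simplex; [posB]
    makes this a Sperner labelling. In a fine grid, a corner of the resulting cube is within [d] of
    corners of all four labels, hence in every [B i]. *)
Lemma kkm (R : realType) (B : 'I_4 -> set 'rV[R]_4) :
  (forall i x, simplex R x -> B i x -> \forall y \near x, simplex R y -> B i y) ->
  (forall i x, simplex R x -> B i x -> 0 < x 0 i) ->
  simplex R `<=` \bigcup_i B i ->
  exists2 x, simplex R x & forall i, B i x.
Proof.
move=> oB posB cover.
have [d d0 Hd] := lebesgue_number (@compact_simplex R) oB cover.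
(* Corners of a grid cube differ by at most [2 / n] in each coordinate. *)
pose n := Num.bound (2 / d).
have dn : 2 / d < n%:R by rewrite archi_boundP// divr_ge0// ltW.
have n0 : (0 < n)%N by rewrite -(ltr0n R) (le_lt_trans _ dn)// divr_ge0// ltW.
have [l lP] : exists l : nat -> nat -> nat -> 'I_4, forall x y z,
    inside n x y z -> forall q, simplex R q -> ball (grid_pt R n x y z) d q ->
    B (l x y z) q.
  have /choice[f fP] : forall p : nat * nat * nat, exists i : 'I_4,
      inside n p.1.1 p.1.2 p.2 -> forall q, simplex R q ->
      ball (grid_pt R n p.1.1 p.1.2 p.2) d q -> B i q.
    move=> p; have [/(simplex_grid_pt R n0) Kp|] := boolP (inside _ _ _ _).
      by have [i Hi] := Hd _ Kp; exists i.
    by exists ord0.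
  by exists (fun x y z => f (x, y, z)) => x y z; exact: (fP (x, y, z)).
have [x y z ins|x [y [z H]]] := sperner (l := l) n0.
  apply: (@positive_grid_pt R) => //; apply: posB; first exact: simplex_grid_pt.
  by apply: lP => //; [exact: simplex_grid_pt|exact: ballxx].
have [a [b [c [a1 b1 c1 ins _]]]] := H ord0.
exists (grid_pt R n (a + x) (b + y) (c + z)); first exact: simplex_grid_pt.
move=> i; have [a' [b' [c' [a1' b1' c1' ins' <-]]]] := H i.
apply: lP => //; first exact: simplex_grid_pt.
split=> // k j; rewrite !mxE -ball_normE /= -mulrBl normrM normfV.
rewrite (@ger0_norm _ n%:R)// ltr_pdivrMr ?ltr0n//.
have {}dn : 2 < d * n%:R by rewrite mulrC -ltr_pdivrMr.
apply: le_lt_trans dn.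
have E (p q r : nat) : (p <= 1)%N -> (q <= 1)%N ->
    -1 <= ((p + r)%:R - (q + r)%:R : R) <= 1.
  move=> p1 q1; rewrite !natrD.
  have : 0 <= (p%:R : R) <= 1 by rewrite ler0n (ler_nat R _ 1).
  have : 0 <= (q%:R : R) <= 1 by rewrite ler0n (ler_nat R _ 1).
  lra.
have := E _ _ x a1' a1; have := E _ _ y b1' b1; have := E _ _ z c1' c1.
rewrite ler_norml; case: j => [[|[|[|[|]]]]] //= _; lra.
Qed.

(** * The regions of the cut disk *)

Section Psum.
Variable R : realType.
Implicit Types (x : 'rV[R]_4).

Lemma psum0 x : psum x 0 = 0.
Proof. by rewrite /psum big_pred0. Qed.

Lemma psumS x (i : 'I_4) : psum x i.+1 = psum x i + x 0 i.
Proof.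
rewrite /psum (bigD1 i)//= addrC; congr (_ + _); apply: eq_bigl => j.
by rewrite ltnS -val_eqE/=; lia.
Qed.

Lemma le_psum x m n : simplex R x -> (m <= n)%N -> psum x m <= psum x n.
Proof.
move=> [x0 _] mn; rewrite /psum [leRHS](bigID (fun j : 'I_4 => (j < m)%N))/=.
rewrite [X in _ <= X + _](eq_bigl (fun j : 'I_4 => (j < m)%N)) => [|j].
  by rewrite lerDl sumr_ge0.
by apply/andb_idl => /leq_trans; exact.
Qed.

Lemma psum_itv x n : simplex R x -> 0 <= psum x n <= 1.
Proof.
move=> xD; rewrite -{1}(psum0 x) le_psum//=.
have [x0 <-] := xD; rewrite /psum [leRHS](bigID (fun j : 'I_4 => (j < n)%N))/=.
by rewrite lerDl sumr_ge0.
Qed.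

End Psum.

Section Chord.
Variable R : realType.
Implicit Types (a b s t : R) (p q : plane R) (x : 'rV[R]_4).

(* Signed distance from [p] to the line through the points of parameters [a]
   and [b], positive on the side of the arc from [a] to [b]; if [a = b], it is
   the distance to the tangent line. *)
Definition chord_side a b p : R :=
  p.1 * cos (pi * (a + b)) - p.2 * sin (pi * (a + b)) - cos (pi * (b - a)).

Lemma chord_side_circle a b t :
  chord_side a b (circle_pt t) = 2 * sin (pi * (t - a)) * sin (pi * (b - t)).
Proof.
rewrite /chord_side /= mulNr opprK -cosB.
rewrite (_ : 2 * pi * t - pi * (a + b) = pi * (t - a) - pi * (b - t)); last by ring.
rewrite (_ : pi * (b - a) = pi * (t - a) + pi * (b - t)); last by ring.
by rewrite cosB cosD; ring.
Qed.

Lemma chord_side_conv a b s p q :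
  chord_side a b ((1 - s) *: p + s *: q) =
  (1 - s) * chord_side a b p + s * chord_side a b q.
Proof. by rewrite /chord_side /= /GRing.scale /=; ring. Qed.

Lemma chord_side_segment a b p :
  segment (circle_pt a) (circle_pt b) p -> chord_side a b p = 0.
Proof.
move=> [s _ <-]; rewrite chord_side_conv !chord_side_circle !subrr mulr0 sin0.
by ring.
Qed.

(** In the orthonormal frame at the mid-angle [m], [p] has coordinates [cos h] and [w], and the end
    points have [cos h] and [sin h] or [- sin h]. Since [p] is in the open disk,
    [w ^+ 2 < sin h ^+ 2], which places it between them. *)
Lemma chord_side_eq0 a b p : open_unit_disk R p -> chord_side a b p = 0 ->
  segment (circle_pt a) (circle_pt b) p.
Proof.
rewrite /open_unit_disk /= => pD /eqP; rewrite subr_eq0 => /eqP pE.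
set m := pi * (a + b) in pE; set h := pi * (b - a) in pE.
have aE : circle_pt a = (cos (m - h), - sin (m - h)).
  by rewrite /circle_pt (_ : m - h = 2 * pi * a)// /m /h; ring.
have bE : circle_pt b = (cos (m + h), - sin (m + h)).
  by rewrite /circle_pt (_ : m + h = 2 * pi * b)// /m /h; ring.
have m1 := cos2Dsin2 m; have h1 := cos2Dsin2 h.
pose w := p.1 * sin m + p.2 * cos m.
have wh : w ^+ 2 < sin h ^+ 2.
  have -> : w ^+ 2 = (p.1 ^+ 2 + p.2 ^+ 2) * (cos m ^+ 2 + sin m ^+ 2)
                     - cos h ^+ 2 by rewrite -pE /w; ring.
  by rewrite m1; lra.
have h0 : sin h != 0 by apply: contraTneq wh => ->; rewrite expr0n -leNgt sqr_ge0.
have [p1 p2] : p.1 = cos h * cos m + w * sin m /\ p.2 = w * cos m - cos h * sin m.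
  rewrite -pE /w; split.
    by rewrite -[LHS]mulr1 -m1; ring.
  by rewrite -[LHS]mulr1 -m1; ring.
(* The solution of [w = (1 - 2 * s) * sin h]. *)
pose s : R := (1 - w / sin h) / 2.
have e1 : (1 - s) * cos (m - h) + s * cos (m + h) = p.1.
  by rewrite p1 cosB cosD /s; field.
have e2 : (1 - s) * - sin (m - h) + s * - sin (m + h) = p.2.
  by rewrite p2 sinB sinD /s; field.
exists s; last by rewrite aE bE [RHS]surjective_pairing -e1 -e2.
have : `|w / sin h| <= 1.
  rewrite normrM normfV ler_pdivrMr ?normr_gt0// mul1r.
  by rewrite -ler_sqr ?nnegrE// !real_normK ?num_real// ltW.
by rewrite ler_norml /= in_itv /= /s => /andP[? ?]; apply/andP; split; lra.
Qed.

Lemma continuous_psum k : continuous (fun x => psum x k).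
Proof. exact: continuous_coord_sum. Qed.

(* Positive when [p] lies on the side of the [i]-th arc with respect to the chord
   from [psum x k] to [psum x k.+2]. *)
Definition side x (i : 'I_4) (k : nat) p : R :=
  (-1) ^+ (~~ (k <= i < k.+2)%N) * chord_side (psum x k) (psum x k.+2) p.

Lemma side_conv x i k s p q :
  side x i k ((1 - s) *: p + s *: q) = (1 - s) * side x i k p + s * side x i k q.
Proof. by rewrite /side chord_side_conv; ring. Qed.

Lemma continuous_side i k :
  continuous (fun u : plane R * 'rV[R]_4 => side u.2 i k u.1).
Proof.
have cD (f g : plane R * 'rV[R]_4 -> R) : continuous f -> continuous g ->
    continuous (fun u => f u + g u).
  by move=> cf cg u; apply: cvgD; [exact: cf|exact: cg].
have cB (f g : plane R * 'rV[R]_4 -> R) : continuous f -> continuous g ->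
    continuous (fun u => f u - g u).
  by move=> cf cg u; apply: cvgB; [exact: cf|exact: cg].
have cM (f g : plane R * 'rV[R]_4 -> R) : continuous f -> continuous g ->
    continuous (fun u => f u * g u).
  by move=> cf cg u; apply: cvgM; [exact: cf|exact: cg].
have cC (c : R) : continuous (fun _ : plane R * 'rV[R]_4 => c).
  exact: cst_continuous.
have ccos (f : plane R * 'rV[R]_4 -> R) : continuous f ->
    continuous (fun u => cos (f u)).
  by move=> cf u; apply: continuous_comp; [exact: cf|exact: continuous_cos].
have csin (f : plane R * 'rV[R]_4 -> R) : continuous f ->
    continuous (fun u => sin (f u)).
  by move=> cf u; apply: continuous_comp; [exact: cf|exact: continuous_sin].
have cpsum n : continuous (fun u : plane R * 'rV[R]_4 => psum u.2 n).
  move=> u; apply: (@continuous_comp _ _ _ snd (fun x => psum x n)).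
    exact: cvg_snd.
  exact: continuous_psum.
have cfst : continuous (fun u : plane R * 'rV[R]_4 => u.1.1 : R).
  move=> u; apply: (@continuous_comp _ _ _ fst fst); exact: cvg_fst.
have csnd : continuous (fun u : plane R * 'rV[R]_4 => u.1.2 : R).
  move=> u; apply: (@continuous_comp _ _ _ fst snd).
    exact: cvg_fst.
  exact: cvg_snd.
apply: (cM _ _); first exact: cC.
apply: (cB _ _); first apply: (cB _ _).
- by apply: (cM _ _) => //; apply: (ccos _); apply: (cM _ _) => //; exact: cD.
- by apply: (cM _ _) => //; apply: (csin _); apply: (cM _ _) => //; exact: cD.
- by apply: (ccos _); apply: (cM _ _) => //; exact: cB.
Qed.

Lemma continuous_sidel x i k : continuous (side x i k).
Proof.
move=> p U /(@continuous_side i k (p, x))[[A B] /= [pA xB] AB].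
apply: filterS pA => q Aq; apply: (AB (q, x)).
by split=> //=; exact: nbhs_singleton.
Qed.

Lemma side_eq0_chords x i k p : (k < 2)%N -> open_unit_disk R p ->
  side x i k p = 0 -> chords x p.
Proof.
move=> k2 pD /eqP; rewrite mulf_eq0 signr_eq0 /= => /eqP /(chord_side_eq0 pD).
case: k k2 => [|[|]]// _; last by right.
by left; rewrite (_ : (1, 0) = circle_pt (psum x 0))//
  /circle_pt psum0 mulr0 cos0 sin0 oppr0.
Qed.

Lemma side_chords x i k p : 0 < side x i k p ->
  ~ segment (circle_pt (psum x k)) (circle_pt (psum x k.+2)) p.
Proof. by move=> + /chord_side_segment p0; rewrite /side p0 mulr0 ltxx. Qed.

(** The [i]-th arc lies between the two ends of the chord, before both or after both. In the last
    two cases the sign in [side] is absorbed by reversing one difference of parameters. *)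
Lemma side_circle x (i : 'I_4) k t : simplex R x -> psum x i <= t <= psum x i.+1 ->
  exists u v, [/\ side x i k (circle_pt t) = 2 * sin (pi * u) * sin (pi * v),
    0 <= u <= 1, 0 <= v <= 1 &
    psum x i < t < psum x i.+1 -> 0 < u < 1 /\ 0 < v < 1].
Proof.
move=> xD /andP[it ti]; rewrite /side chord_side_circle.
have /andP[? ?] := psum_itv k xD; have /andP[? ?] := psum_itv k.+2 xD.
have /andP[? ?] := psum_itv i xD; have /andP[? ?] := psum_itv i.+1 xD.
have ? := le_psum xD (leqW (leqnSn k)).
have [/andP[/(le_psum xD) ki /(le_psum xD) ik]|] := boolP (k <= i < k.+2)%N.
  exists (t - psum x k), (psum x k.+2 - t); split.
  - by rewrite mul1r.
  - by apply/andP; split; lra.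
  - by apply/andP; split; lra.
  - by move=> /andP[? ?]; split; apply/andP; split; lra.
rewrite negb_and -ltnNge -leqNgt => /orP[/(le_psum xD) ik|/(le_psum xD) ki].
  exists (psum x k - t), (psum x k.+2 - t); split.
  - by rewrite -opprB mulrN sinN; ring.
  - by apply/andP; split; lra.
  - by apply/andP; split; lra.
  - by move=> /andP[? ?]; split; apply/andP; split; lra.
exists (t - psum x k), (t - psum x k.+2); split.
- by rewrite -[_ - t]opprB (mulrN pi) sinN; ring.
- by apply/andP; split; lra.
- by apply/andP; split; lra.
- by move=> /andP[? ?]; split; apply/andP; split; lra.
Qed.

Lemma side_circle_ge0 x (i : 'I_4) k t : simplex R x ->
  psum x i <= t <= psum x i.+1 -> 0 <= side x i k (circle_pt t).
Proof.
move=> xD /(side_circle k xD)[u [v [-> u01 v01 _]]].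
have sin_ge0 w : 0 <= w <= 1 -> 0 <= sin (pi * w).
  move=> /andP[w0 w1]; rewrite sin_ge0_pi// mulr_ge0 ?pi_ge0//=.
  by rewrite ler_piMr ?pi_ge0.
by rewrite !mulr_ge0 ?sin_ge0.
Qed.

Lemma side_circle_gt0 x (i : 'I_4) k t : simplex R x ->
  psum x i < t < psum x i.+1 -> 0 < side x i k (circle_pt t).
Proof.
move=> xD /[dup] /andP[/ltW it /ltW ti].
have /(side_circle k xD)[u [v [-> _ _ uv]]] : psum x i <= t <= psum x i.+1.
  by rewrite it ti.
have sin_gt0 w : 0 < w < 1 -> 0 < sin (pi * w).
  move=> /andP[w0 w1]; rewrite sin_gt0_pi// mulr_gt0 ?pi_gt0//=.
  by rewrite gtr_pMr ?pi_gt0.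
by move=> /uv[? ?]; rewrite !mulr_gt0 ?sin_gt0.
Qed.

Definition convex_region x i : set (plane R) :=
  [set p | open_unit_disk R p /\ forall k, (k < 2)%N -> 0 < side x i k p].

(** A zero of [side] in the disk lies on a chord, so [side] keeps a constant sign on a component of
    the cut disk; this sign is positive near the arc. *)
Lemma region_sub x i : simplex R x -> region x i `<=` convex_region x i.
Proof.
move=> xD p [xi0 px arcK]; split=> [|k k2]; first by case: px.
set K := connected_component _ _ in arcK.
have [q Kq q0] : exists2 q, K q & 0 < side x i k q.
  (* The midpoint of the arc, since [side] may vanish at its ends. *)
  pose t := psum x i + x 0 i / 2.
  have /side_circle_gt0 t0 : psum x i < t < psum x i.+1.
    by rewrite psumS /t; apply/andP; split; lra.
  have /arcK Kt : circle_arc x i (circle_pt t).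
    by exists t => //=; rewrite in_itv/= psumS /t; apply/andP; split; lra.
  have : nbhs (circle_pt t) (side x i k @^-1` [set r | 0 < r]).
    apply: (@continuous_sidel x i k); apply: open_nbhs_nbhs; split=> /=.
      exact: open_gt.
    exact: t0.
  by move=> /Kt[q [Kq q0]]; exists q.
rewrite ltNge; apply/negP => p0.
have : connected (side x i k @` K).
  apply: connected_continuous_connected; first exact: component_connected.
  by apply: continuous_subspaceT; exact: continuous_sidel.
move=> /connected_intervalP/(_ (side x i k p) (side x i k q)).
case/(_ _ _ 0).
- by exists p => //; exact: connected_component_refl.
- by exists q.
- by rewrite p0 ltW.
move=> r /connected_component_sub[rD rx] /(side_eq0_chords k2 rD); exact: rx.
Qed.

(** The segment from a point [q] of the arc to [p] stays in the convex region except perhaps at [q],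
    because [side] is affine, nonnegative at [q] and positive at [p]. So [q] is a limit of points of
    the component of [p]. *)
Lemma sub_region x i : simplex R x -> 0 < x 0 i -> convex_region x i `<=` region x i.
Proof.
move=> xD xi0 p [pD ps]; have cut q : convex_region x i q -> cut_disk x q.
  move=> [qD qs]; split=> // -[].
    rewrite (_ : (1, 0) = circle_pt (psum x 0)) => [|].
      by apply: (@side_chords x i 0%N); exact: qs.
    by rewrite /circle_pt psum0 mulr0 cos0 sin0 oppr0.
  by apply: (@side_chords x i 1%N); exact: qs.
split=> //; first exact: cut.
move=> _ [t /= + <-]; rewrite in_itv /= => tx.
set q := circle_pt t.
pose g (s : R) : plane R := (1 - s) *: q + s *: p.
have cg : continuous g.
  move=> s; apply: cvgD; apply: cvgZr_tmp; last exact: cvg_id.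
  by apply: cvgB; [exact: cvg_cst|exact: cvg_id].
have gx s : s \in `]0, 1] -> convex_region x i (g s).
  rewrite in_itv /= => /andP[s0 s1]; split => [|k k2]; last first.
    rewrite side_conv; apply: ltr_wpDl; last exact: mulr_gt0 s0 (ps _ k2).
    by apply: mulr_ge0; [rewrite subr_ge0|exact: side_circle_ge0].
  have q1 : q.1 ^+ 2 + q.2 ^+ 2 = 1 by rewrite /= sqrrN cos2Dsin2.
  have := ltr_pM2l s0 (p.1 ^+ 2 + p.2 ^+ 2) 1; rewrite [_ < 1]pD mulr1 => ps1.
  (* This quantity is the convexity defect of the squared norm. *)
  have : 0 <= s * (1 - s) * ((p.1 - q.1) ^+ 2 + (p.2 - q.2) ^+ 2).
    by rewrite !mulr_ge0 ?subr_ge0 ?addr_ge0 ?sqr_ge0// ltW.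
  have -> : s * (1 - s) * ((p.1 - q.1) ^+ 2 + (p.2 - q.2) ^+ 2) =
      (1 - s) * (q.1 ^+ 2 + q.2 ^+ 2) + s * (p.1 ^+ 2 + p.2 ^+ 2) -
      (((1 - s) * q.1 + s * p.1) ^+ 2 + ((1 - s) * q.2 + s * p.2) ^+ 2) by ring.
  by rewrite q1 /open_unit_disk /g /= /GRing.scale /=; lra.
have gK : g @` `]0, 1] `<=` connected_component (cut_disk x) p.
  apply: connected_component_max.
  - exists 1; first by rewrite /= in_itv /= ltr01 lexx.
    by rewrite /g subrr scale0r add0r scale1r.
  - by move=> _ [s /gx/cut gs <-].
  - apply: connected_continuous_connected.
      by apply/connected_intervalP/interval_is_interval.
    exact: continuous_subspaceT.
move=> U qU.
have : \forall s \near (0 : R)^'+, U (g s) /\ s \in `]0, 1].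
  apply: filterI.
    apply: cvg_at_right_filter (cg 0) _ _.
    by rewrite /g subr0 scale1r scale0r addr0.
  near=> s; rewrite in_itv/=; apply/andP; split; near: s.
    exact: nbhs_right_gt.
  exact: nbhs_right_le.
move=> /(@filter_ex _ _ (at_right_proper_filter (0 : R)))[s [Us s01]].
by exists (g s); split=> //; apply: gK; exists s.
Unshelve. all: by end_near. Qed.

(** By joint continuity each strict inequality persists near [(p, x)]; compactness of [K] gives a
    neighbourhood of [x] common to all [p]. *)
Lemma near_sub_convex_region x i (K : set (plane R)) : compact K ->
  K `<=` convex_region x i -> \forall y \near x, K `<=` convex_region y i.
Proof.
move=> cK Kx.
have nearK k : (k < 2)%N -> \forall y \near x, K `<=` [set p | 0 < side y i k p].
  move=> k2; pose P y p := 0 < side y i k p.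
  apply: ((compact_near_coveringP K).1 cK _ (nbhs x) P) => p /Kx[_ /(_ k k2) pk].
  have : nbhs (p, x)
      ((fun u : plane R * 'rV[R]_4 => side u.2 i k u.1) @^-1` [set r | 0 < r]).
    apply: (@continuous_side i k); apply: open_nbhs_nbhs.
    by split; [exact: open_gt|exact: pk].
  by [].
have := nearK 0%N isT; have := nearK 1%N isT.
apply: filterS2 => y K1 K0 p Kp; split; first by have [] := Kx p Kp.
by case=> [|[|]]// _; [exact: K0|exact: K1].
Qed.

End Chord.

(** * Openness and positivity of the sets [A_ C i], and the application of KKM *)

Section A_.
Variables (R : realType) (C : {fset set (plane R)}).
Implicit Types (i : 'I_4) (x : 'rV[R]_4).

(** A common point of the three sets lies in [region x i], which is thus nonempty. *)
Lemma A_gt0 i x : A_ C i x -> 0 < x 0 i.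
Proof.
move=> [_ [D [_ [z Dz] DD]]].
by have [] := DD ord0 ord_max isT z (conj (Dz ord0 I) (Dz ord_max I)).
Qed.

(** The triple [D] chosen for [x] serves for all nearby [y]: its pairwise intersections are compact
    and finitely many. *)
Lemma A_open i x : (forall X, X \in C -> compact X) -> A_ C i x ->
  \forall y \near x, simplex R y -> A_ C i y.
Proof.
move=> cC Ax; have xi0 := A_gt0 Ax; have [xD [D [DC D0 DD]]] := Ax.
have near_pos : \forall y \near x, 0 < (y : 'rV[R]_4) 0 i.
  have : nbhs x ((fun y : 'rV[R]_4 => y 0 i) @^-1` [set r | 0 < r]).
    apply: (@coord_continuous R 1 4 0 i); apply: open_nbhs_nbhs.
    by split; [exact: open_gt|exact: xi0].
  by [].
have near_sub (jk : 'I_3 * 'I_3) : \forall y \near x, (jk.1 < jk.2)%N ->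
    D jk.1 `&` D jk.2 `<=` convex_region y i.
  have [lt_jk|_] := boolP (jk.1 < jk.2)%N; last first.
    by apply: filterS (@filterT _ _ (nbhs_filter x)).
  have : \forall y \near x, D jk.1 `&` D jk.2 `<=` convex_region y i.
    apply: near_sub_convex_region.
      apply: compact_closedI; first exact/cC/DC.
      exact: compact_closed (@norm_hausdorff R (R^o * R^o)%type) (cC _ (DC _)).
    exact: subset_trans (DD _ _ lt_jk) (region_sub xD).
  by apply: filterS => y.
have near_sub_all := filter_forall (nbhs_filter x) near_sub.
near=> y => yD; split=> //; exists D; split=> // j k jk.
have y0 : 0 < y 0 i by near: y.
apply: subset_trans (sub_region yD y0).
have yD_jk : forall jk : 'I_3 * 'I_3, (jk.1 < jk.2)%N ->
  D jk.1 `&` D jk.2 `<=` convex_region y i by near: y.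
exact: (yD_jk (j, k)).
Unshelve. all: by end_near. Qed.

End A_.

Unset Implicit Arguments.

Theorem theorem5 (R : realType) (C : {fset set (plane R)})
  (card_C : (4 <= #|` C|)%N)
  (compact_C : forall X, X \in C -> compact X)
  (convex_C : forall X, X \in C -> convex_set X)
  (disk_C : forall X, X \in C -> X `<=` open_unit_disk R)
  (pq_C : pq_property 4 3 C)
  (cover : simplex R `<=` \bigcup_i A_ C i) :
  exists x, (\bigcap_i A_ C i) x.
Proof.
have [i x _|i x _|//|x _ Ax] := @kkm R (A_ C).
- exact: A_open.
- exact: A_gt0.
- by exists x => i _.
Qed.
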